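(* Let $\nu,\mu\in\mathbb R$ and let $\lambda$ be a constant. The adjoint difference equation $L^{*}[w(z)]=0$ of $L[y(z)]=0$, which can be written as $$\sigma(z+1)\,\Delta_{\nu-\mu-1}\nabla_{\nu-\mu}w(z)-\tau_{\nu-\mu-2}(z+1)\,\nabla_{\nu-\mu}w(z)+(\lambda-\kappa_{2\nu-2\mu-1})\,w(z)=0,$$ or as $$\tilde\sigma_{\nu-\mu-2}(z+1)\,\Delta_{\nu-\mu-1}\nabla_{\nu-\mu}w(z)-\tfrac12\tau_{\nu-\mu-2}(z+1)\big[\Delta_{\nu-\mu}w(z)+\nabla_{\nu-\mu}w(z)\big]+(\lambda-\kappa_{2\nu-2\mu-1})\,w(z)=0,$$ is also a difference equation of hypergeometric type on non-uniform lattices; that is, $\tilde\sigma_{\nu-\mu-2}(z+1)$ and $-\tau_{\nu-\mu-2}(z+1)$ are polynomials of degree at most two and at most one, respectively, in the variable $x_{\nu-\mu}(z)$, and $\lambda-\kappa_{2\nu-2\mu-1}$ is a constant.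
   Context: Lattice and differences. $x(s)$, $s\in\mathbb C$, is a non-uniform lattice: either $x(s)=c_1q^s+c_2q^{-s}+c_3$ with $c_1c_2\ne0$ ($q\neq0,1$ fixed, with a fixed value of $\log q$ and $q^s=e^{s\log q}$), or $x(s)=\tilde c_1s^2+\tilde c_2s+\tilde c_3$ with $\tilde c_1\tilde c_2\neq0$. For real $\eta$, $x_\eta(s)=x(s+\frac{\eta}{2})$. $\Delta f(s)=f(s+1)-f(s)$, $\nabla f(s)=f(s)-f(s-1)$, $\Delta_\eta f(s)=\Delta f(s)/\Delta x_\eta(s)$, $\nabla_\eta f(s)=\nabla f(s)/\nabla x_\eta(s)$. All equations are considered at points where the denominators do not vanish. Coefficients. $\tilde\sigma[x]$ and $\tilde\tau[x]$ are polynomials in $x$ of degrees at most two and one; $\tau(z)=\tilde\tau[x(z)]$ and $\sigma(z)=\tilde\sigma[x(z)]-\frac12\tilde\tau[x(z)]\nabla x_1(z)$. For real $\eta$, $\tau_\eta$ and $\tilde\sigma_\eta$ are defined by $\tau_\eta(z)\nabla x_{\eta+1}(z)=\sigma(z+\eta)-\sigma(z)+\tau(z+\eta)\nabla x_1(z+\eta)$ and $\tilde\sigma_\eta(z)=\sigma(z)+\frac12\tau_\eta(z)\nabla x_{\eta+1}(z)$. Put $\alpha(\eta)=\frac{q^{\eta/2}+q^{-\eta/2}}2$, $\gamma(\eta)=\frac{q^{\eta/2}-q^{-\eta/2}}{q^{1/2}-q^{-1/2}}$ in the $q$-case and $\alpha(\eta)=1$, $\gamma(\eta)=\eta$ in the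 quadratic case, and $\kappa_\eta=\alpha(\eta-1)\tilde\tau'+\frac12\gamma(\eta-1)\tilde\sigma''$ (derivatives with respect to $x$), so that $\tau_\eta(z)-\kappa_{2\eta+1}x_\eta(z)$ is constant in $z$. Operators. $L[y(z)]=\sigma(z)\Delta_{\nu-\mu-1}\nabla_{\nu-\mu}y(z)+\tau_{\nu-\mu}(z)\Delta_{\nu-\mu}y(z)+\lambda y(z)$. Its adjoint operator is $L^{*}[w(z)]=\sigma^{*}(z)\Delta_{\nu-\mu-1}\nabla_{\nu-\mu}w(z)+\tau^{*}_{\nu-\mu}(z)\Delta_{\nu-\mu}w(z)+\lambda^{*}_{\nu-\mu}w(z)$, where $\sigma^{*}(z)=\sigma(z-1)+\tau_{\nu-\mu}(z-1)\nabla x_{\nu-\mu-1}(z)$, $\tau^{*}_{\nu-\mu}(z)=\frac{\sigma(z+1)-\sigma(z-1)-\tau_{\nu-\mu}(z-1)\nabla x_{\nu-\mu-1}(z)}{\Delta x_{\nu-\mu-1}(z)}$, $\lambda^{*}_{\nu-\mu}=\lambda-\frac{\Delta}{\Delta x_{\nu-\mu-1}(z)}\Big(\frac{\tau_{\nu-\mu}(z-1)\nabla x_{\nu-\mu-1}(z)-\nabla\sigma(z)}{\nabla x_{\nu-\mu}(z)}\Big)$. *)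

(* Defs.v *)
From mathcomp Require Import all_boot all_order all_algebra.
From mathcomp Require Import complex.
From mathcomp Require Import all_classical all_reals all_analysis.

Set Implicit Arguments.
Unset Strict Implicit.
Unset Printing Implicit Defensive.

Import Order.TTheory GRing.Theory Num.Theory.
Local Open Scope ring_scope.
Local Open Scope complex_scope.

Definition cexp (R : realType) (z : R[i]) : R[i] :=
  (expR (complex.Re z) * cos (complex.Im z))
    +i* (expR (complex.Re z) * sin (complex.Im z)).

(* [logq] is the chosen value of log q: every power of q is taken with it. *)
Inductive lattice (R : realType) : Type :=
| QLattice (q logq c1 c2 c3 : R[i])
    of q != 0 & q != 1 & cexp logq = q & c1 * c2 != 0
| QuadraticLattice (c1 c2 c3 : R[i]) of c1 * c2 != 0.

Definition lattice_fun (R : realType) (X : lattice R) (s : R[i]) : R[i] :=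
  match X with
  | QLattice _ logq c1 c2 c3 _ _ _ _ =>
      c1 * cexp (s * logq) + c2 * cexp (- s * logq) + c3
  | QuadraticLattice c1 c2 c3 _ => c1 * s ^+ 2 + c2 * s + c3
  end.

Section Lattice.
Variables (R : realType) (X : lattice R).
Implicit Types (eta : R) (f : R[i] -> R[i]) (s z : R[i]).

Definition x_ eta s : R[i] := lattice_fun X (s + (eta / 2)%:C).

Definition fdiff f s : R[i] := f (s + 1) - f s.
Definition bdiff f s : R[i] := f s - f (s - 1).

(* The divided differences Delta_eta and nabla_eta.  Division by zero
   returns 0, so these are meaningful only where the denominator is nonzero. *)
Definition fdiffx eta f s : R[i] := fdiff f s / fdiff (x_ eta) s.
Definition bdiffx eta f s : R[i] := bdiff f s / bdiff (x_ eta) s.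

Definition alpha eta : R[i] :=
  match X with
  | QLattice _ logq _ _ _ _ _ _ _ =>
      (cexp ((eta / 2)%:C * logq) + cexp (- (eta / 2)%:C * logq)) / 2
  | QuadraticLattice _ _ _ _ => 1
  end.

Definition gamma eta : R[i] :=
  match X with
  | QLattice _ logq _ _ _ _ _ _ _ =>
      (cexp ((eta / 2)%:C * logq) - cexp (- (eta / 2)%:C * logq))
      / (cexp ((1 / 2)%:C * logq) - cexp (- (1 / 2)%:C * logq))
  | QuadraticLattice _ _ _ _ => eta%:C
  end.

Section Coefficients.
Variables sigmat taut : {poly R[i]}.

Definition tau z : R[i] := taut.[lattice_fun X z].

Definition sigma z : R[i] :=
  sigmat.[lattice_fun X z] - 1 / 2 * tau z * bdiff (x_ 1) z.

(* Meaningful where bdiff (x_ (eta + 1)) z != 0.  Elsewhere the value is 0, but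
   the product tau_ eta z * bdiff (x_ (eta + 1)) z is still the numerator, which
   has bdiff (x_ (eta + 1)) z as a factor. *)
Definition tau_ eta z : R[i] :=
  (sigma (z + eta%:C) - sigma z
     + tau (z + eta%:C) * bdiff (x_ 1) (z + eta%:C))
  / bdiff (x_ (eta + 1)) z.

Definition sigmat_ eta z : R[i] :=
  sigma z + 1 / 2 * tau_ eta z * bdiff (x_ (eta + 1)) z.

(* For deg taut <= 1 and deg sigmat <= 2 these derivatives are constant
   polynomials, hence the evaluation at 0. *)
Definition kappa eta : R[i] :=
  alpha (eta - 1) * (taut^`()).[0]
  + 1 / 2 * gamma (eta - 1) * (sigmat^`(2)).[0].

End Coefficients.

(* The operator a Delta_(k-1) nabla_k + b Delta_k + c and its adjoint, as a map
   on the coefficients (a, b, c). *)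
Record dcoef := DCoef {
  coef2 : R[i] -> R[i];
  coef1 : R[i] -> R[i];
  coef0 : R[i] -> R[i] }.

Definition diffop (k : R) (p : dcoef) (w : R[i] -> R[i]) z : R[i] :=
  coef2 p z * fdiffx (k - 1) (bdiffx k w) z
  + coef1 p z * fdiffx k w z + coef0 p z * w z.

Definition adjoint_coef (k : R) (p : dcoef) : dcoef :=
  let s := coef2 p in let t := coef1 p in
  {| coef2 := fun z => s (z - 1) + t (z - 1) * bdiff (x_ (k - 1)) z;
     coef1 := fun z =>
       (s (z + 1) - s (z - 1) - t (z - 1) * bdiff (x_ (k - 1)) z)
       / fdiff (x_ (k - 1)) z;
     coef0 := fun z =>
       coef0 p z
       - fdiffx (k - 1)
           (fun u => (t (u - 1) * bdiff (x_ (k - 1)) u - bdiff s u)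
                     / bdiff (x_ k) u) z |}.

Definition L_coef (sigmat taut : {poly R[i]}) (k : R) (lambda : R[i]) : dcoef :=
  {| coef2 := sigma sigmat taut;
     coef1 := tau_ sigmat taut k;
     coef0 := fun _ => lambda |}.

Definition L_op (sigmat taut : {poly R[i]}) (k : R) (lambda : R[i]) :=
  diffop k (L_coef sigmat taut k lambda).

Definition Lstar_op (sigmat taut : {poly R[i]}) (k : R) (lambda : R[i]) :=
  diffop k (adjoint_coef k (L_coef sigmat taut k lambda)).

(* The denominators occurring in the adjoint equation are all nonzero at z.
   Note that bdiff (x_ k) (z + 1) = fdiff (x_ k) z. *)
Definition regular (k : R) z : Prop :=
  [/\ fdiff (x_ (k - 1)) z != 0, fdiff (x_ k) z != 0 & bdiff (x_ k) z != 0].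

(* On the domain D, the coefficients of
     S Delta_(k-1) nabla_k w + T/2 (Delta_k w + nabla_k w) + l w = 0
   are those of an equation of hypergeometric type in the variable x_k. *)
Definition hypergeometric_type (k : R) (D : R[i] -> Prop)
    (S T l : R[i] -> R[i]) : Prop :=
  [/\ exists P : {poly R[i]}, (size P <= 3)%N /\
        (forall z, D z -> S z = P.[x_ k z]),
      exists Q : {poly R[i]}, (size Q <= 2)%N /\
        (forall z, D z -> T z = Q.[x_ k z])
    & exists c : R[i], forall z, D z -> l z = c].

End Lattice.

(* Main.v *)
Require Import Defs.
From mathcomp Require Import all_boot all_order all_algebra.
From mathcomp Require Import complex ring.
From mathcomp Require Import all_classical all_reals all_analysis.

(** The adjoint equation is again of hypergeometric type because the lattice has
addition formulas.  With J u = x (u + 1/2) - x (u - 1/2), both kinds of lattice satisfy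
- x (u + eta/2) + x (u - eta/2) = 2 alpha(eta) x u + constant,
- x (u + eta/2) - x (u - eta/2) = gamma(eta) J u,
- J u ^ 2 = a polynomial of degree at most two in x u,
together with duplication formulas for alpha and gamma (lattice_sum,
lattice_diff, jump_sqr, gamma_double, alpha_double).  These are the only places
where the two kinds of lattice are treated separately; everything else follows
from them by algebra.

In tau_ eta z the points z and z + eta are symmetric about u = z + eta/2, where
x_ eta z = x u and bdiff (x_ (eta + 1)) z = J u.  The addition formulas express
the values of x and J at the two points through x u and J u; replacing J u by
- J u exchanges the two values of x, and exchanges the two values of J up to
sign.  Under this substitution the numerator of tau_ eta z is odd, so it is J u
times an affine function of x u (tau_numerator_factor); the duplication formulas
identify its slope as kappa (2 eta + 1).  In sigmat_ eta z, which is even, J u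
appears only through its square, so sigmat_ eta z is a polynomial of degree at
most two in x_ eta z (sigmat_poly).  Since
x_ (k - 2) (z + 1) = x_ k z, this is the hypergeometric type of the adjoint
equation.

The adjoint coefficients are identified by comparing numerators.  The product
tau_ k (z - 1) * bdiff (x_ (k - 1)) z is the numerator of tau_ k at z - 1, which
differs from the numerators of tau_ (k - 2) at z + 1 and of tau_ (k - 1) at z by
differences of values of sigma only.  Hence the first-order coefficient is
- tau_ (k - 2) (z + 1) (adjoint_coef1), and the correction to lambda is the
divided difference of the affine function tau_ (k - 1), that is, its slope
kappa (2 k - 1) (adjoint_coef0_inner).  The two displayed forms then differ by
the relation between forward and backward divided differences
(fdiffx_bdiffx). *)

Set Implicit Arguments.
Unset Strict Implicit.
Unset Printing Implicit Defensive.

Import Order.TTheory GRing.Theory Num.Theory.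
Local Open Scope ring_scope.
Local Open Scope complex_scope.

(** * The complex exponential *)

Section Exponential.
Variable R : realType.
Implicit Types z t : R[i].

Lemma cexp0 : cexp (0 : R[i]) = 1.
Proof. by rewrite /cexp /= expR0 cos0 sin0 mulr1 mulr0. Qed.

Lemma cexpD z t : cexp (z + t) = cexp z * cexp t.
Proof.
case: z t => [a b] [c d]; rewrite /cexp /= expRD cosD sinD.
by apply/eqP; rewrite eq_complex /=; apply/andP; split; apply/eqP; ring.
Qed.

Lemma cexp_neq0 z : cexp z != 0.
Proof.
have: cexp z * cexp (- z) != 0 by rewrite -cexpD subrr cexp0 oner_eq0.
by rewrite mulf_eq0 negb_or => /andP[].
Qed.

Lemma cexpN z : cexp (- z) = (cexp z)^-1.
Proof.
by apply: (mulfI (cexp_neq0 z)); rewrite -cexpD subrr cexp0 divff ?cexp_neq0.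
Qed.

End Exponential.

(** * Addition formulas on the lattice *)

Section Lattice.
Variables (R : realType) (X : lattice R).
Implicit Types (eta : R) (u z : R[i]).

Local Notation x := (lattice_fun X).

(** The central difference of the lattice: bdiff (x_ (eta + 1)) z is its value at
the midpoint of z and z + eta (bdiff_x). *)
Definition jump u : R[i] := x (u + (1 / 2)%:C) - x (u - (1 / 2)%:C).

Lemma half_twice : ((1 / 2)%:C : R[i]) + (1 / 2)%:C = 1.
Proof. by rewrite -rmorphD /= (_ : _ + _ = 1) //; field. Qed.

Lemma cexp_half_sqr (L : R[i]) :
  cexp ((1 / 2)%:C * L) * cexp ((1 / 2)%:C * L) = cexp L.
Proof. by rewrite -cexpD -mulrDl half_twice mul1r. Qed.

(** On a q-lattice the shift by eta/2 multiplies the two exponentials by inverse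
factors, so the sum scales both of them by 2 alpha; on a quadratic lattice the
linear terms in eta cancel. *)
Lemma lattice_sum eta : exists b, forall u,
  x (u + (eta / 2)%:C) + x (u - (eta / 2)%:C) = 2 * alpha X eta * x u + b.
Proof.
rewrite /alpha; case: X => [q L c1 c2 c3 _ _ _ _|c1 c2 c3 _] /=.
  exists (2 * c3
    - (cexp ((eta / 2)%:C * L) + cexp (- (eta / 2)%:C * L)) * c3) => u.
  rewrite !mulNr !mulrDl !mulNr !cexpN !cexpD !cexpN.
  have := cexp_neq0 (u * L); have := cexp_neq0 ((eta / 2)%:C * L).
  move: (cexp _) (cexp _) => p e p0 e0.
  by field; rewrite p0 e0.
exists (2 * c1 * (eta / 2)%:C ^+ 2) => u; ring.
Qed.

(** The difference is proportional to the one for eta = 1: on a q-lattice both are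
multiples of c1 q^u - c2 q^(-u), on a quadratic lattice of 2 c1 u + c2.  The
condition q != 1 makes the denominator of gamma nonzero. *)
Lemma lattice_diff eta u :
  x (u + (eta / 2)%:C) - x (u - (eta / 2)%:C) = gamma X eta * jump u.
Proof.
rewrite /jump /gamma; case: X => [q L c1 c2 c3 _ q1 Lq _|c1 c2 c3 _] /=.
  have := cexp_half_sqr L; rewrite Lq => Eq; move: q1; rewrite -{}Eq -subr_eq0.
  rewrite !mulNr !mulrDl !mulNr !cexpN !cexpD !cexpN.
  have := cexp_neq0 (u * L); have := cexp_neq0 ((eta / 2)%:C * L).
  have := cexp_neq0 ((1 / 2)%:C * L).
  move: (cexp _) (cexp _) (cexp _) => r p e r0 p0 e0 r1.
  by field; rewrite r0 p0 e0 r1.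
have -> : eta%:C = (eta / 2)%:C + (eta / 2)%:C :> R[i].
  by rewrite -rmorphD /=; congr (_ %:C); field.
transitivity (2 * (eta / 2)%:C
  * ((2 * c1 * u + c2) * ((1 / 2)%:C + (1 / 2)%:C))); last by ring.
rewrite half_twice; ring.
Qed.

(** The curve traced by (x, jump) is a conic: on a q-lattice x - c3 and jump are,
up to a factor, the sum and the difference of two exponentials with constant
product c1 c2; on a quadratic lattice jump^2 is the discriminant of the quadratic
equation for u with x u prescribed. *)
Lemma jump_sqr : exists a b c, forall u,
  jump u ^+ 2 = a * x u ^+ 2 + b * x u + c.
Proof.
rewrite /jump; case: X => [q L c1 c2 c3 _ q1 Lq _|c1 c2 c3 _] /=.
  set r := cexp ((1 / 2)%:C * L); set a := (r - r^-1) ^+ 2.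
  exists a, (- 2 * a * c3), (a * (c3 ^+ 2 - 4 * c1 * c2)) => u.
  rewrite !mulNr !mulrDl !mulNr !cexpN !cexpD !cexpN /a -/r.
  have := cexp_neq0 (u * L); have := cexp_neq0 ((1 / 2)%:C * L); rewrite -/r.
  by move: (cexp _) => e r0 e0; field; rewrite r0 e0.
exists 0, (4 * c1), (c2 ^+ 2 - 4 * c1 * c3) => u.
transitivity (((2 * c1 * u + c2) * ((1 / 2)%:C + (1 / 2)%:C)) ^+ 2).
  by congr (_ ^+ _); ring.
rewrite half_twice; ring.
Qed.

Lemma gamma_double eta : gamma X (2 * eta) = 2 * alpha X eta * gamma X eta.
Proof.
rewrite /alpha /gamma; case: X => [q L c1 c2 c3 _ q1 Lq _|c1 c2 c3 _] /=.
  have -> : (2 * eta / 2)%:C = (eta / 2)%:C + (eta / 2)%:C :> R[i].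
    by rewrite -rmorphD /=; congr (_ %:C); field.
  rewrite !mulNr !mulrDl !cexpN !cexpD.
  have := cexp_neq0 ((eta / 2)%:C * L).
  move: (_ - _)^-1 (cexp _) => s p p0.
  by field.
by rewrite rmorphM /= mulr1 rmorph_nat.
Qed.

(** On a q-lattice this is the formula cosh 2t = cosh^2 t + sinh^2 t, as
(alpha 2 - 1) / 2 is the square of half the denominator of gamma; on a quadratic
lattice alpha is 1 everywhere. *)
Lemma alpha_double eta :
  alpha X (2 * eta) = alpha X eta ^+ 2 + (alpha X 2 - 1) / 2 * gamma X eta ^+ 2.
Proof.
rewrite /alpha /gamma; case: X => [q L c1 c2 c3 _ q1 Lq _|c1 c2 c3 _] /=.
  have := cexp_half_sqr L; rewrite Lq => Eq; move: q1; rewrite -{}Eq -subr_eq0.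
  have -> : (2 * eta / 2)%:C = (eta / 2)%:C + (eta / 2)%:C :> R[i].
    by rewrite -rmorphD /=; congr (_ %:C); field.
  have -> : (2 / 2)%:C = (1 / 2)%:C + (1 / 2)%:C :> R[i].
    by rewrite -rmorphD /=; congr (_ %:C); field.
  rewrite !mulNr !mulrDl !cexpN !cexpD.
  have := cexp_neq0 ((eta / 2)%:C * L); have := cexp_neq0 ((1 / 2)%:C * L).
  move: (cexp _) (cexp _) => r p r0 p0 r1.
  by field; rewrite ?r0 ?p0 ?r1.
by ring.
Qed.

Lemma lattice_shift eta : exists b, forall u,
  x (u + (eta / 2)%:C) = alpha X eta * x u + b + gamma X eta / 2 * jump u /\
  x (u - (eta / 2)%:C) = alpha X eta * x u + b - gamma X eta / 2 * jump u.
Proof.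
have [b xD] := lattice_sum eta; exists (b / 2) => u.
have := xD u; have := lattice_diff eta u.
move: (x (u + _)) (x (u - _)) (x u) (alpha _ _) (gamma _ _) (jump u).
move=> p m y a g j hd hs; split.
  by transitivity (((p + m) + (p - m)) / 2); [|rewrite hs hd]; field.
by transitivity (((p + m) - (p - m)) / 2); [|rewrite hs hd]; field.
Qed.

(** Applying lattice_shift at u + 1/2 and u - 1/2 produces the second central
difference of x at u, which lattice_shift for a full step makes affine in x. *)
Lemma jump_shift eta : exists b, forall u,
  jump (u + (eta / 2)%:C) =
    alpha X eta * jump u + gamma X eta * ((alpha X 2 - 1) * x u + b) /\
  jump (u - (eta / 2)%:C) =
    alpha X eta * jump u - gamma X eta * ((alpha X 2 - 1) * x u + b).
Proof.
have [b xe] := lattice_shift eta; have [c x1] := lattice_shift 2.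
exists c => u.
pose h : R[i] := (1 / 2)%:C; set e := (eta / 2)%:C.
have jump_jump : jump (u + h) - jump (u - h) = 2 * ((alpha X 2 - 1) * x u + c).
  have one_step : (2 / 2)%:C = h + h :> R[i].
    by rewrite half_twice divff ?pnatr_eq0.
  have [] := x1 u; rewrite one_step opprD !(addrA u) => xp xm.
  rewrite /jump -/h addrK subrK xp xm; ring.
rewrite {1 3}/jump -/h.
rewrite (_ : u + e + h = u + h + e); last by ring.
rewrite (_ : u + e - h = u - h + e); last by ring.
rewrite (_ : u - e + h = u + h - e); last by ring.
rewrite (_ : u - e - h = u - h - e); last by ring.
rewrite (xe (u + h)).1 (xe (u + h)).2 (xe (u - h)).1 (xe (u - h)).2.
have -> : (alpha X 2 - 1) * x u + c = (jump (u + h) - jump (u - h)) / 2.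
  by rewrite jump_jump; field.
by split; rewrite {3}/jump -/h; ring.
Qed.

Lemma bdiff_x eta z : bdiff (x_ X (eta + 1)) z = jump (z + (eta / 2)%:C).
Proof.
rewrite /bdiff /x_ /jump mulrDl rmorphD /= -half_twice; congr (x _ - x _); ring.
Qed.

Lemma x_add2 eta z : x_ X (eta + 2) z = x_ X eta (z + 1).
Proof.
by rewrite /x_ mulrDl divff ?pnatr_eq0 // rmorphD /= addrAC addrA.
Qed.

Lemma fdiffE f z : fdiff f z = bdiff f (z + 1).
Proof. by rewrite /fdiff /bdiff addrK. Qed.

(** * The coefficients of the equation *)

Section Coefficients.
Variables sigmat taut : {poly R[i]}.
Hypothesis size_sigmat : (size sigmat <= 3)%N.
Hypothesis size_taut : (size taut <= 2)%N.

Local Notation tau := (tau X taut).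
Local Notation sigma := (sigma X sigmat taut).
Local Notation tau_ := (tau_ X sigmat taut).
Local Notation kappa := (kappa X sigmat taut).
Local Notation x_ := (x_ X).

Definition tau_numerator eta z :=
  sigma (z + eta%:C) - sigma z + tau (z + eta%:C) * bdiff (x_ 1) (z + eta%:C).

Lemma bdiff_x1 z : bdiff (x_ 1) z = jump z.
Proof. by have := bdiff_x 0 z; rewrite add0r mul0r addr0. Qed.

Lemma tauE z : tau z = taut`_0 + taut`_1 * x z.
Proof.
rewrite /Defs.tau (horner_coef_wide _ size_taut).
by rewrite !big_ord_recr big_ord0 /= add0r expr0 mulr1.
Qed.

Lemma sigmaE z : sigma z =
  sigmat`_0 + sigmat`_1 * x z + sigmat`_2 * x z ^+ 2 - 1 / 2 * tau z * jump z.
Proof.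
rewrite /Defs.sigma bdiff_x1 (horner_coef_wide _ size_sigmat).
by rewrite !big_ord_recr big_ord0 /= add0r expr0 mulr1.
Qed.

Lemma kappaE eta : kappa (2 * eta + 1) =
  alpha X (2 * eta) * taut`_1 + gamma X (2 * eta) * sigmat`_2.
Proof.
rewrite /Defs.kappa addrK !horner_coef0 derivnS derivn1 !coef_deriv !mulr1n.
by rewrite -[_ *+ 2]mulr_natr; field.
Qed.

Lemma add_from_half eta u : u - (eta / 2)%:C + eta%:C = u + (eta / 2)%:C.
Proof.
by rewrite -addrA -rmorphN -rmorphD /=; congr (_ + _%:C); field.
Qed.

(** After the shift formulas are substituted, the numerator is a polynomial of
degree two in jump that changes sign with jump, hence a multiple of jump.  The
values of alpha and gamma at 2 eta come from the quadratic terms, through the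
duplication formulas. *)
Lemma tau_numerator_factor eta : exists c, forall z,
  tau_numerator eta z = (kappa (2 * eta + 1) * x_ eta z + c) * bdiff (x_ (eta + 1)) z.
Proof.
have [b xe] := lattice_shift eta; have [d je] := jump_shift eta.
set a := alpha X eta; set g := gamma X eta.
exists (sigmat`_1 * g + 2 * sigmat`_2 * g * b
        + taut`_0 * a + taut`_1 * (a * b + g ^+ 2 * d / 2)) => z.
(* The symmetric coordinate u is the midpoint of z and z + eta. *)
rewrite -[z](addrK (eta / 2)%:C); move: (z + _) => u.
rewrite /tau_numerator kappaE gamma_double alpha_double bdiff_x /Defs.x_ bdiff_x1.
rewrite add_from_half subrK !sigmaE !tauE.
rewrite (xe u).1 (xe u).2 (je u).1 (je u).2 -/a -/g.
by field.
Qed.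

(** This holds even where the denominator of tau_ vanishes, because the numerator
then vanishes with it; the adjoint coefficients use tau_ at such points. *)
Lemma tau_mulE eta z : tau_ eta z * bdiff (x_ (eta + 1)) z = tau_numerator eta z.
Proof.
have [c numE] := tau_numerator_factor eta.
have [d0|d0] := eqVneq (bdiff (x_ (eta + 1)) z) 0; last by rewrite divfK.
by rewrite numE d0 !mulr0.
Qed.

Lemma tau_affine eta : exists c, forall z, bdiff (x_ (eta + 1)) z != 0 ->
  tau_ eta z = kappa (2 * eta + 1) * x_ eta z + c.
Proof.
have [c numE] := tau_numerator_factor eta; exists c => z d0.
by apply: (mulIf d0); rewrite tau_mulE.
Qed.

(** sigmat_ is the mean of sigma z and the value of sigma + tau * jump at z + eta,
hence unchanged when the sign of jump at the midpoint is reversed: jump occurs in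
it only squared, and jump_sqr expresses the square through x. *)
Lemma sigmat_poly eta : exists P : {poly R[i]}, (size P <= 3)%N /\
  forall z, sigmat_ X sigmat taut eta z = P.[x_ eta z].
Proof.
have [b xe] := lattice_shift eta; have [d je] := jump_shift eta.
have [j2 [j1 [j0 jj]]] := jump_sqr.
set a := alpha X eta; set g := gamma X eta; set m := alpha X 2 - 1.
exists (Poly [:: sigmat`_0 + sigmat`_1 * b + sigmat`_2 * b ^+ 2
    + g * d / 2 * (taut`_0 + taut`_1 * b)
    + (sigmat`_2 * g ^+ 2 + taut`_1 * g * a) / 4 * j0;
  sigmat`_1 * a + 2 * sigmat`_2 * a * b
    + g / 2 * (taut`_0 * m + taut`_1 * (a * d + b * m))
    + (sigmat`_2 * g ^+ 2 + taut`_1 * g * a) / 4 * j1;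
  sigmat`_2 * a ^+ 2 + taut`_1 * g * a * m / 2
    + (sigmat`_2 * g ^+ 2 + taut`_1 * g * a) / 4 * j2]).
split=> [|z]; first exact: size_Poly.
rewrite -[z](addrK (eta / 2)%:C); move: (z + _) => u.
rewrite horner_Poly /= mul0r add0r /sigmat_ -mulrA tau_mulE /tau_numerator bdiff_x1.
rewrite /Defs.x_ add_from_half subrK !sigmaE !tauE.
rewrite (xe u).1 (xe u).2 (je u).1 (je u).2 -/a -/g -/m.
move: (jj u); move: (jump u) (x u) => J y JJ.
(* Collecting the powers of J, before J ^+ 2 is replaced by its value. *)
transitivity (sigmat`_0 + sigmat`_1 * (a * y + b) + sigmat`_2 * (a * y + b) ^+ 2
  + g / 2 * (m * y + d) * (taut`_0 + taut`_1 * (a * y + b))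
  + (sigmat`_2 * g ^+ 2 + taut`_1 * g * a) / 4 * J ^+ 2).
  by field.
by rewrite JJ; field.
Qed.

(** * The adjoint equation *)

Variable k : R.

Lemma bdiff_x_sub1 z : bdiff (x_ (k - 1)) z = bdiff (x_ (k + 1)) (z - 1).
Proof.
rewrite /bdiff (_ : k + 1 = k - 1 + 2); last by ring.
by rewrite !x_add2 !subrK.
Qed.

(** Both sides are quotients by the same lattice difference, and their numerators
agree because z - 1 + k and z + 1 + (k - 2) are the same point. *)
Lemma adjoint_coef1 z :
  (sigma (z + 1) - sigma (z - 1) - tau_ k (z - 1) * bdiff (x_ (k - 1)) z)
    / fdiff (x_ (k - 1)) z = - tau_ (k - 2) (z + 1).
Proof.
rewrite bdiff_x_sub1 tau_mulE /tau_numerator fdiffE /Defs.tau_ -mulNr.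
rewrite rmorphB /= rmorph_nat.
rewrite (_ : k - 2 + 1 = k - 1); last by ring.
rewrite (_ : z + 1 + (k%:C - 2) = z - 1 + k%:C); last by ring.
congr (_ / _); ring.
Qed.

(** The function whose divided difference corrects lambda is tau_ (k - 1): after
bdiff sigma is subtracted, the numerator compares sigma at z and at
z - 1 + k = z + (k - 1). *)
Lemma adjoint_coef0_inner z :
  (tau_ k (z - 1) * bdiff (x_ (k - 1)) z - bdiff sigma z) / bdiff (x_ k) z
  = tau_ (k - 1) z.
Proof.
rewrite bdiff_x_sub1 tau_mulE /tau_numerator /Defs.tau_ subrK /bdiff.
rewrite rmorphB /= (_ : z - 1 + k%:C = z + (k%:C - 1)); last by ring.
congr (_ / _); ring.
Qed.

(** The forward divided difference at z is the backward one at z + 1, so the two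
differ by the increment of the backward one. *)
Lemma fdiffx_bdiffx w z : fdiff (x_ (k - 1)) z != 0 ->
  fdiffx X k w z = bdiffx X k w z
    + fdiff (x_ (k - 1)) z * fdiffx X (k - 1) (bdiffx X k w) z.
Proof.
move=> h0; rewrite [fdiffx X (k - 1) _ _]/fdiffx mulrC divfK //.
rewrite [in RHS]/fdiff addrC subrK.
by rewrite /fdiffx /bdiffx !fdiffE.
Qed.

Lemma adjoint_operatorE lambda w z : regular X k z ->
  Lstar_op X sigmat taut k lambda w z
  = sigma (z + 1) * fdiffx X (k - 1) (bdiffx X k w) z
    - tau_ (k - 2) (z + 1) * bdiffx X k w z
    + (lambda - kappa (2 * k - 1)) * w z.
Proof.
move=> [h0 f0 b0]; rewrite /Lstar_op /diffop /= adjoint_coef1.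
(* The second-order coefficient is read off from the first-order one, as the
   adjoint satisfies sigma^* + tau^* fdiff (x_ (k - 1)) z = sigma (z + 1). *)
have c2 : sigma (z - 1) + tau_ k (z - 1) * bdiff (x_ (k - 1)) z =
    sigma (z + 1) + tau_ (k - 2) (z + 1) * fdiff (x_ (k - 1)) z.
  have /(canRL (divfK h0)) := adjoint_coef1 z.
  rewrite mulNr => /eqP; rewrite eq_sym -subr_eq0 => /eqP E.
  apply/eqP; rewrite -subr_eq0; apply/eqP; rewrite -[RHS]E; ring.
have c0 : fdiffx X (k - 1) (fun u => (tau_ k (u - 1) * bdiff (x_ (k - 1)) u
    - bdiff sigma u) / bdiff (x_ k) u) z = kappa (2 * k - 1).
  have [c tauE1] := tau_affine (k - 1); rewrite subrK in tauE1.
  rewrite /fdiffx {1}/fdiff !adjoint_coef0_inner !tauE1 -?fdiffE //.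
  rewrite (_ : 2 * (k - 1) + 1 = 2 * k - 1); last by ring.
  apply: (mulIf h0); rewrite divfK // /fdiff; ring.
rewrite c0 c2.
rewrite (fdiffx_bdiffx _ h0); ring.
Qed.

Lemma adjoint_operator_symmE lambda w z : regular X k z ->
  Lstar_op X sigmat taut k lambda w z
  = sigmat_ X sigmat taut (k - 2) (z + 1)
      * fdiffx X (k - 1) (bdiffx X k w) z
    - 1 / 2 * tau_ (k - 2) (z + 1) * (fdiffx X k w z + bdiffx X k w z)
    + (lambda - kappa (2 * k - 1)) * w z.
Proof.
move=> reg; rewrite adjoint_operatorE //; case: reg => h0 _ _.
rewrite (fdiffx_bdiffx _ h0) /sigmat_ (_ : k - 2 + 1 = k - 1); last by ring.
by rewrite -fdiffE; field.
Qed.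

End Coefficients.
End Lattice.

Theorem theorem3p1 (R : realType) (X : lattice R) (sigmat taut : {poly R[i]})
    (hsigmat : (size sigmat <= 3)%N) (htaut : (size taut <= 2)%N)
    (nu mu : R) (lambda : R[i]) :
  [/\ forall (w : R[i] -> R[i]) (z : R[i]), regular X (nu - mu) z ->
        Lstar_op X sigmat taut (nu - mu) lambda w z
        = sigma X sigmat taut (z + 1)
            * fdiffx X (nu - mu - 1) (bdiffx X (nu - mu) w) z
          - tau_ X sigmat taut (nu - mu - 2) (z + 1) * bdiffx X (nu - mu) w z
          + (lambda - kappa X sigmat taut (2 * nu - 2 * mu - 1)) * w z,
      forall (w : R[i] -> R[i]) (z : R[i]), regular X (nu - mu) z ->
        Lstar_op X sigmat taut (nu - mu) lambda w z
        = sigmat_ X sigmat taut (nu - mu - 2) (z + 1)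
            * fdiffx X (nu - mu - 1) (bdiffx X (nu - mu) w) z
          - 1 / 2 * tau_ X sigmat taut (nu - mu - 2) (z + 1)
            * (fdiffx X (nu - mu) w z + bdiffx X (nu - mu) w z)
          + (lambda - kappa X sigmat taut (2 * nu - 2 * mu - 1)) * w z
    & hypergeometric_type X (nu - mu)
        (fun z => fdiff (x_ X (nu - mu - 1)) z != 0)
        (fun z => sigmat_ X sigmat taut (nu - mu - 2) (z + 1))
        (fun z => - tau_ X sigmat taut (nu - mu - 2) (z + 1))
        (fun _ => lambda - kappa X sigmat taut (2 * nu - 2 * mu - 1))].
Proof.
rewrite -mulrBr; split.
- by move=> w z; exact: adjoint_operatorE.
- by move=> w z; exact: adjoint_operator_symmE.
have x_kE z : x_ X (nu - mu - 2) (z + 1) = x_ X (nu - mu) z.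
  by rewrite -x_add2 subrK.
split; last by exists (lambda - kappa X sigmat taut (2 * (nu - mu) - 1)).
- have [P [szP sigmatE]] := sigmat_poly X hsigmat htaut (nu - mu - 2).
  by exists P; split=> // z _; rewrite sigmatE x_kE.
have [c tauE] := tau_affine X hsigmat htaut (nu - mu - 2).
exists (Poly [:: - c; - kappa X sigmat taut (2 * (nu - mu - 2) + 1)]).
split=> [|z h0]; first exact: size_Poly.
rewrite horner_Poly /= mul0r add0r tauE ?x_kE; last first.
  by rewrite -fdiffE (_ : nu - mu - 2 + 1 = nu - mu - 1) //; ring.
by ring.
Qed.
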